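(* Let $p$ be a prime and let $G$ be a semi-abelian finite $p$-group which is non-simple and non-trivial (that is, $|G|\geq p^2$). Then $G$ has a non-inner automorphism of order $p$.
   Context: A finite $p$-group $G$ is called semi-abelian (in M. Y. Xu's terminology, strongly semi-$p$-abelian) if for all $x,y\in G$ and every positive integer $n$ one has $(xy^{-1})^{p^n}=1 \Leftrightarrow x^{p^n}=y^{p^n}$. *)

(* Defs.v *)
From HB Require Import structures.
From mathcomp Require Import all_boot all_fingroup all_solvable.

Set Implicit Arguments.
Unset Strict Implicit.
Unset Printing Implicit Defensive.

Local Open Scope group_scope.

Definition semi_abelian (p : nat) (gT : finGroupType) (G : {group gT}) : Prop :=
  forall x y : gT, x \in G -> y \in G ->
  forall n : nat, (0 < n)%N ->
    (x * y^-1) ^+ (p ^ n)%N = 1 <-> x ^+ (p ^ n)%N = y ^+ (p ^ n)%N.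

Definition inner_automorphisms (gT : finGroupType) (G : {group gT}) :
    {set {perm gT}} :=
  conj_aut G @* G.

(* Main.v *)
(** Suppose every automorphism of order [p] is inner, and write [M(N)] for
    [Ohm_1(Z(N))].  An endomorphism fixing a subgroup [N] pointwise and moving
    every element by [M(N)] has order dividing [p], so it is conjugation by an
    element of [C_G(N)].  Semi-abelianness gives [(x m)^p = x^p] for [m] of
    order [p], which makes such endomorphisms easy to construct.  With [N] maximal,
    every [g m] with [g] outside [N] and [m] in [M(N)] is conjugate to [g] under
    [C_G(N)]; it follows that [Z(N)] is not central and that
    [Z(G) <= C_G(N) <= N].

    Let [N] be the intersection of two maximal subgroups [N1 = N<a>] and
    [N2 = N<b>].  If [C = C_G(N)] is not contained in [N], one may arrange that
    [G = N C] with [Z(N) <= Z(G)]; then elements of order [p] in [C] lie in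
    [Z(N)], at most [p] elements of [C] share a [p]-th power, and those powers
    lie in [Z(N)], contradicting [|C : Z(N)| = p^2].

    So [C_G(N) = Z(N)].  The pairs [(m1, m2)] in [M(N)^2] with
    [[m1, b] = [m2, a]] are the derivations from [G / N] to [M(N)]; there are at
    least [|M(N)|^2 / |[M(N), G]| > |M(N)|] of them.  They are all inner, of the
    form [([a, h], [b, h])] with [h] in [Z(N)]; as they have order [p], the
    [p]-th power map sends these [h] into the kernel of
    [h |-> ([a, h], [b, h])], and its own kernel lies in [M(N)], so there are at
    most [|M(N)|] inner ones. *)

Require Import Defs.
From mathcomp Require Import all_boot all_fingroup all_solvable.

Set Implicit Arguments.
Unset Strict Implicit.
Unset Printing Implicit Defensive.
Local Open Scope group_scope.

(** * Powers in semi-abelian groups and elements of order [p] in a centre *)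

(** The quotient of [x * m] by [x] is a conjugate of [m], so its [p]-th power is trivial. *)
Lemma semi_abelian_expgMr p (gT : finGroupType) (G : {group gT}) x m :
  semi_abelian p G -> x \in G -> m \in G -> m ^+ p = 1 ->
  (x * m) ^+ p = x ^+ p.
Proof.
move=> sG Gx Gm mp1; have [+ _] := sG (x * m) x (groupM Gx Gm) Gx 1%N isT.
rewrite expn1; apply.
by rewrite -[x in x * m]invgK -mulgA -conjgE -conjXg mp1 conj1g.
Qed.

Lemma semi_abelian_expg_eq p (gT : finGroupType) (G : {group gT}) x y :
  semi_abelian p G -> x \in G -> y \in G -> x ^+ p = y ^+ p ->
  (x * y^-1) ^+ p = 1.
Proof.
by move=> sG Gx Gy exy; have [_] := sG x y Gx Gy 1%N isT; rewrite expn1; apply.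
Qed.

Lemma mem_Ohm1_center (p : nat) (gT : finGroupType) (N : {group gT}) m :
  p.-group N -> (m \in 'Ohm_1('Z(N))) = (m \in 'Z(N)) && (m ^+ p == 1).
Proof.
move=> pN; have abZ := center_abelian N.
rewrite (OhmEabelian (pgroupS (center_sub N) pN)) ?(abelianS (Ohm_sub _ _)) //.
by rewrite expn1 !inE.
Qed.

(** * Extending morphisms, and automorphisms fixing a subgroup pointwise *)

(** The extension sends [x * a ^+ i] to [f x * y ^+ i]. It is well defined because [K] meets [<[a]>]
    in the powers of [a ^+ p], and multiplicative because [f] turns conjugation by [a] into
    conjugation by [y]. *)
Lemma cyclic_extension p (gT rT : finGroupType) (K : {group gT})
    (f : {morphism K >-> rT}) (a : gT) (y : rT) :
  a \in 'N(K) -> (forall i, (a ^+ i \in K) = (p %| i)) ->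
  f (a ^+ p) = y ^+ p -> {in K, forall x, f (x ^ a) = f x ^ y} ->
  exists2 g : {morphism K <*> <[a]> >-> rT}, {in K, g =1 f} & g a = y.
Proof.
move=> nKa aK fap fJ.
have fa i : a ^+ i \in K -> f (a ^+ i) = y ^+ i.
  rewrite aK => /dvdnP[k ->].
  by rewrite mulnC !expgM -fap (morphX f k) ?aK.
have dvd_ya : #[y] %| #[a].
  by rewrite order_dvdn -fa expg_order ?morph1.
have nKA : <[a]> \subset 'N(K) by rewrite cycle_subG.
have actf : {in K & <[a]>, morph_act 'J 'J f (eltm dvd_ya)}.
  move=> x _ Kx /cycleP[i ->] /=; rewrite eltmE.
  elim: i => [|i IHi]; first by rewrite !conjg1.
  by rewrite !expgSr !conjgM fJ ?IHi // memJ_norm // groupX.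
have eqf : {in K :&: <[a]>, f =1 eltm dvd_ya}.
  by move=> x /setIP[Kx /cycleP[i def_x]]; move: Kx; rewrite def_x eltmE => /fa.
exists (pprodm_morphism nKA actf eqf) => [x Kx|] /=.
  exact: pprodmEl.
rewrite pprodmEr ?cycle_id //. apply: eltm_id.
Qed.

Definition order_p_inner p (gT : finGroupType) (G : {group gT}) : Prop :=
  forall f : {perm gT}, f \in Aut G -> #[f] = p -> f \in inner_automorphisms G.

Lemma inner_of_fixing (p : nat) (gT : finGroupType) (G N : {group gT})
    (f : {morphism G >-> gT}) :
  prime p -> p.-group G -> order_p_inner p G -> N \subset G ->
  {in N, f =1 id} -> {in G, forall x, x^-1 * f x \in 'Ohm_1('Z(N))} ->
  exists2 h, h \in 'C_G(N) & {in G, forall x, f x = x ^ h}.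
Proof.
move=> p_pr pG innG sNG fN fM; have pN := pgroupS sNG pG.
have fMN x : x \in G -> x^-1 * f x \in N.
  by move/fM; apply/subsetP/(subset_trans (Ohm_sub _ _))/center_sub.
have fx x : f x = x * (x^-1 * f x) by rewrite mulKVg.
have injf : 'injm f.
  apply/subsetP=> x Kx; have [Gx fx1] := (dom_ker Kx, mker Kx); rewrite inE.
  have Nx : x \in N by rewrite -groupV -[x^-1]mulg1 -[1]fx1 fMN.
  by rewrite -fx1 fN.
have imf : f @* G = G.
  apply/eqP; rewrite eqEcard card_injm // leqnn andbT.
  apply/subsetP=> _ /morphimP[x _ Gx ->].
  by rewrite fx groupM // (subsetP sNG) ?fMN.
pose s := aut injf imf.
have sE : {in G, s =1 f} by exact: autE.
have AutGs : s \in Aut G by exact: Aut_aut.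
(* The displacement [x^-1 * f x] lies in [N], hence is fixed by [f]; each iteration multiplies by it
   once more. *)
have s_iter n x : x \in G -> (s ^+ n) x = x * (x^-1 * f x) ^+ n.
  move=> Gx; elim: n => [|n IHn]; first by rewrite perm1 mulg1.
  have Nu := fMN x Gx; have Gu := subsetP sNG _ Nu.
  rewrite expgSr permM IHn sE ?groupM ?groupX // morphM ?groupX //.
  rewrite (morphX _ n Gu) (fN _ Nu) {1}fx.
  by rewrite -mulgA -expgS.
have sp1 : s ^+ p = 1.
  apply: (eq_Aut (A := G)); rewrite ?groupX ?group1 // => x Gx.
  rewrite s_iter // perm1.
  by have:= fM x Gx; rewrite (mem_Ohm1_center _ pN) => /andP[_ /eqP->]; rewrite mulg1.
have s_inn : s \in inner_automorphisms G.
  have: #[s] %| p by rewrite order_dvdn sp1.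
  case/primeP: p_pr => _ /(_ #[s]) H /H /pred2P[|/innG]; last exact.
  by move/eqP; rewrite order_eq1 => /eqP->; rewrite group1.
case/morphimP: s_inn => h nGh Gh defs.
have fh x : x \in G -> f x = x ^ h.
  by move=> Gx; rewrite -sE // /s -/s defs conj_autE.
exists h => //; rewrite inE Gh; apply/centP=> x Nx.
apply/commute_sym/commgP/conjg_fixP; rewrite -fh ?fN //; exact: (subsetP sNG).
Qed.

(** The displacement of [y * z] is that of [y] conjugated by [z], times that of [z]; so the elements
    displaced by [M] form a subgroup, and generators suffice. *)
Lemma fixing_displacement (gT : finGroupType) (G M : {group gT}) (S : {set gT})
    (f : {morphism G >-> gT}) :
  G \subset 'N(M) -> S \subset G -> G \subset <<S>> ->
  {in S, forall x, x^-1 * f x \in M} -> {in G, forall x, x^-1 * f x \in M}.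
Proof.
move=> nMG sSG sGS fS x Gx.
pose H := [set x in G | x^-1 * f x \in M].
have gH : group_set H.
  apply/group_setP; split=> [|y z]; first by rewrite inE invg1 morph1 mulg1 !group1.
  rewrite !inE => /andP[Gy My] /andP[Gz Mz]; rewrite groupM // morphM //=.
  rewrite (_ : _ * _ = (y^-1 * f y) ^ z * (z^-1 * f z)); last first.
    by rewrite conjgE invMg !mulgA mulgK.
  by rewrite groupM // memJ_norm // (subsetP nMG).
have: x \in Group gH.
  apply: subsetP x Gx; apply: subset_trans sGS _; rewrite gen_subG.
  by apply/subsetP=> y Sy; rewrite inE (subsetP sSG) // fS.
by rewrite inE => /andP[].
Qed.

(** * Prescribed displacements outside maximal subgroups *)

Section Maximal.

Variables (p : nat) (gT : finGroupType) (G : {group gT}).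
Hypotheses (p_pr : prime p) (pG : p.-group G).

Lemma expg_mem_maximal (N : {group gT}) x i :
  maximal N G -> x \in G -> x \notin N -> (x ^+ i \in N) = (p %| i).
Proof.
move=> maxN Gx N'x; have nsNG := p_maximal_normal pG maxN.
have nNx : x \in 'N(N) by exact: (subsetP (normal_norm nsNG)).
have ox : #[coset N x] = p.
  have: #[coset N x] %| p.
    rewrite -(p_maximal_index pG maxN) -card_quotient ?normal_norm //.
    by rewrite order_dvdG ?mem_quotient.
  case/primeP: p_pr => _ H /H /pred2P[/eqP|//].
  by rewrite order_eq1 => /eqP/coset_idr => /(_ nNx) Nx; rewrite Nx in N'x.
rewrite -ox order_dvdn -morphX //; apply/idP/eqP; first exact: coset_id.
by move/coset_idr; apply; rewrite groupX.
Qed.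

Lemma maximal_joinE (N : {group gT}) x :
  maximal N G -> x \in G -> x \notin N -> N * <[x]> = G.
Proof.
move=> maxN Gx N'x; apply: (mulg_normal_maximal _ maxN).
- exact: p_maximal_normal pG _.
- by rewrite cycle_subG.
by rewrite cycle_subG.
Qed.

Lemma maximal_inter_joinE (N1 N2 : {group gT}) a :
  maximal N1 G -> maximal N2 G -> a \in N1 -> a \notin N2 ->
  (N1 :&: N2) * <[a]> = N1.
Proof.
move=> max1 max2 N1a N2'a; have sN1G := proper_sub (maxgroupp max1).
rewrite group_modr ?cycle_subG // (maximal_joinE max2) ?(subsetP sN1G) //.
exact/setIidPl.
Qed.

Hypotheses (sG : semi_abelian p G) (innG : order_p_inner p G).

(** The identity of [N] extends by [g |-> g * m]: [g] and [g * m] have the same [p]-th power, and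
    they act alike on [N] since [m] is central there. *)
Lemma maximal_displacement (N : {group gT}) g m :
  maximal N G -> g \in G -> g \notin N -> m \in 'Ohm_1('Z(N)) ->
  exists2 h, h \in 'C_G(N) & g ^ h = g * m.
Proof.
move=> maxN Gg N'g Mm; have nsNG := p_maximal_normal pG maxN.
have [sNG nNG] := andP nsNG; have pN := pgroupS sNG pG.
have nNg : g \in 'N(N) by exact: (subsetP nNG).
move: (Mm); rewrite (mem_Ohm1_center _ pN) => /andP[/centerP[Nm cNm] /eqP mp1].
have Gm := subsetP sNG m Nm.
have [||x Nx /=|F FN Fg] :=
  @cyclic_extension p _ _ N (idm_morphism N) g (g * m) nNg.
- by move=> i; apply: expg_mem_maximal.
- by rewrite /= (semi_abelian_expgMr sG).
- rewrite conjgM [RHS]conjgE -(cNm (x ^ g)) ?mulKg //.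
  by rewrite memJ_norm.
have defG : N <*> <[g]> = G.
  by rewrite norm_joinEr ?cycle_subG // maximal_joinE.
have sGd : G \subset N <*> <[g]> by rewrite defG.
pose f := restrm_morphism sGd F.
have [//|x Gx|h Ch fh] := @inner_of_fixing p _ G N f p_pr pG innG sNG.
  apply: (@fixing_displacement _ G _ (N :|: [set g]) f) => //.
  - by rewrite gFnorm_trans // gFnorm_trans.
  - by rewrite subUset sNG sub1set.
  - by rewrite -{1}defG joing_idr.
  move=> y /setUP[Ny|/set1P->]; first by rewrite /= /restrm FN //= mulVg group1.
  by rewrite /= /restrm Fg mulKg.
by exists h; rewrite // -fh //= /restrm Fg.
Qed.

(* The commutator condition says that [a |-> a m1], [b |-> b m2] respects
   [a ^ b = a [a, b]]. *)
Lemma two_maximal_displacement (N1 N2 : {group gT}) a b m1 m2 :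
  let N := (N1 :&: N2)%G in
  maximal N1 G -> maximal N2 G ->
  a \in N1 -> a \notin N2 -> b \in N2 -> b \notin N1 ->
  m1 \in 'Ohm_1('Z(N)) -> m2 \in 'Ohm_1('Z(N)) -> [~ m1, b] = [~ m2, a] ->
  exists h, [/\ h \in 'C_G(N), a ^ h = a * m1 & b ^ h = b * m2].
Proof.
move=> N max1 max2 N1a N2'a N2b N1'b Mm1 Mm2 com12.
have [ns1 ns2] := (p_maximal_normal pG max1, p_maximal_normal pG max2).
have [[s1 n1] [s2 n2]] := (andP ns1, andP ns2).
have nsNG : N <| G by apply: normalI.
have [sNG nNG] := andP nsNG; have pN := pgroupS sNG pG.
have [Ga Gb] : a \in G /\ b \in G by rewrite (subsetP s1) // (subsetP s2).
have [nNa nNb] : a \in 'N(N) /\ b \in 'N(N) by rewrite !(subsetP nNG).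
have nMG : G \subset 'N('Ohm_1('Z(N))) by rewrite !gFnorm_trans.
move: (Mm1); rewrite (mem_Ohm1_center _ pN) => /andP[/centerP[Nm1 cNm1] /eqP m1p1].
move: (Mm2); rewrite (mem_Ohm1_center _ pN) => /andP[/centerP[Nm2 cNm2] /eqP m2p1].
have [Gm1 Gm2] := (subsetP sNG _ Nm1, subsetP sNG _ Nm2).
have aN i : (a ^+ i \in N) = (p %| i).
  by rewrite inE groupX // (expg_mem_maximal _ max2).
have [|x Nx /=|F FN Fa] :=
  @cyclic_extension p _ _ N (idm_morphism N) a (a * m1) nNa aN.
- by rewrite /= (semi_abelian_expgMr sG).
- rewrite conjgM [RHS]conjgE -(cNm1 (x ^ a)) ?mulKg //.
  by rewrite memJ_norm.
have def1 : N <*> <[a]> = N1.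
  by rewrite norm_joinEr ?cycle_subG // maximal_inter_joinE.
have sd1 : N1 \subset N <*> <[a]> by rewrite def1.
pose F1 := restrm_morphism sd1 F.
have F1N : {in N, F1 =1 id} by move=> x Nx; rewrite /= /restrm FN.
have F1a : F1 a = a * m1 by rewrite /= /restrm Fa.
clearbody F1.
have nN1b : b \in 'N(N1) by exact: (subsetP n1).
have bN i : (b ^+ i \in N1) = (p %| i) by rewrite (expg_mem_maximal _ max1).
have [|x N1x|F2 F2N1 F2b] := @cyclic_extension p _ _ N1 F1 b (b * m2) nN1b bN.
- rewrite F1N ?(semi_abelian_expgMr sG) // inE bN dvdnn /=.
  by rewrite groupX.
(* Compatibility with conjugation by [b] is multiplicative in [x], so it is checked on [N] and on
   [a] only. *)
- pose E := [set x in N1 | F1 (x ^ b) == F1 x ^ (b * m2)].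
  have gE : group_set E.
    apply/group_setP; split=> [|y z].
      by rewrite inE group1 conj1g morph1 conj1g eqxx.
    rewrite !inE => /andP[N1y /eqP Ey] /andP[N1z /eqP Ez].
    rewrite groupM // andTb conjMg (morphM F1 N1y N1z).
    by rewrite (morphM F1) ?memJ_norm // Ey Ez conjMg eqxx.
  suffices: x \in Group gE by rewrite inE => /andP[_ /eqP].
  apply: subsetP x N1x; rewrite -{1}def1 join_subG cycle_subG.
  apply/andP; split.
    apply/subsetP=> y Ny; have Nyb: y ^ b \in N by rewrite memJ_norm.
    rewrite inE (subsetP (subsetIl N1 N2)) //= F1N // F1N //.
    by rewrite conjgM [X in _ == X]conjgE -(cNm2 _ Nyb) mulKg.
  rewrite inE N1a /=; apply/eqP.
  have Nt : [~ a, b] \in N.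
    rewrite inE; apply/andP; split.
      by rewrite commgEl groupM ?groupV // memJ_norm.
    by rewrite commgEr groupM // memJ_norm ?groupV ?(subsetP n2).
  have Nm1b : m1 ^ b \in N by rewrite memJ_norm.
  have N1t : [~ a, b] \in N1 by case/setIP: Nt.
  have /centerP[Nu cNu] : [~ m2, a] \in 'Z(N).
    have Zm2 : m2 \in 'Z(N) by apply/centerP.
    by rewrite groupM ?groupV // memJ_norm // (subsetP (gFnorm_trans _ nNG)).
  (* With [t = [~ a, b]] and [u = [~ m2, a]], the two sides are [a * m1 * t] and
     [a * u^-1 * t * m1 * u]; they agree because [m1] and [u] are central in [N]. *)
  rewrite F1a conjgM (conjMg a) (conjMg (a ^ b)) [(m1 ^ b) ^ m2]conjgE.
  rewrite -(cNm2 _ Nm1b) mulKg.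
  rewrite [m1 ^ b]conjg_mulR com12.
  rewrite [a ^ b]conjg_mulR (conjMg a) (morphM F1 N1a N1t) F1a (F1N _ Nt).
  rewrite [[~ a, b] ^ m2]conjgE -(cNm2 _ Nt) mulKg.
  rewrite [a ^ m2]conjg_mulR -(invg_comm m2 a).
  move: {Nu N1t com12}[~ a, b] Nt [~ m2, a] cNu => t Nt u cNu.
  by rewrite -!mulgA (cNm1 t) // (mulgA t m1) -(cNu (t * m1)) ?groupM // mulKg.
have defG : N1 <*> <[b]> = G.
  by rewrite norm_joinEr ?cycle_subG // maximal_joinE.
have sGd : G \subset N1 <*> <[b]> by rewrite defG.
pose f := restrm_morphism sGd F2.
have fN : {in N, f =1 id}.
  by move=> x Nx; rewrite /= /restrm F2N1 ?F1N // (subsetP (subsetIl N1 N2)).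
have fa : f a = a * m1 by rewrite /= /restrm F2N1.
have fb : f b = b * m2 by rewrite /= /restrm F2b.
have [//|x Gx|h Ch fh] := @inner_of_fixing p _ G N f p_pr pG innG sNG.
  apply: (@fixing_displacement _ G _ (N :|: [set a] :|: [set b]) f) => //.
  - by rewrite !subUset sNG !sub1set Ga.
  - rewrite -{1}defG -{1}def1 join_subG join_subG !cycle_subG.
    rewrite [N \subset _](subset_trans _ (subset_gen _)) -?setUA ?subsetUl //=.
    by rewrite !mem_gen // !inE eqxx ?orbT.
  move=> y /setUP[/setUP[Ny|/set1P->]|/set1P->]; first by rewrite fN // mulVg group1.
    by rewrite fa mulKg.
  by rewrite fb mulKg.
by exists h; rewrite -!fh.
Qed.

End Maximal.

(** * Centralizers of maximal subgroups and of their intersections *)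

Section Inner.

Variables (p : nat) (gT : finGroupType) (G : {group gT}).
Hypotheses (p_pr : prime p) (pG : p.-group G).
Hypotheses (sG : semi_abelian p G) (innG : order_p_inner p G).
Hypotheses (nsimG : ~~ simple G) (ntG : G :!=: 1).

(** If [N] were trivial, [G] would have order [p] and be simple. *)
Lemma maximal_neq1 (N : {group gT}) : maximal N G -> N :!=: 1.
Proof.
move=> maxN; apply: contra nsimG => /eqP N1; apply/simpleP; split=> // H nsH.
have [H1|ntH] := eqVneq (H : {set gT}) 1; [by left | right].
have oG : #|G| = p by rewrite -(p_maximal_index pG maxN) N1 indexg1.
apply/eqP; rewrite eqEcard (normal_sub nsH) /= oG.
have: #|H| %| p by rewrite -oG cardSg ?normal_sub.
case/primeP: p_pr => _ dv /dv /pred2P[/eqP|-> //].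
by rewrite -trivg_card1 (negPf ntH).
Qed.

Lemma mem_center_mul (N : {group gT}) x y :
  N * <[y]> = G -> x \in 'C_G(N) -> commute x y -> x \in 'Z(G).
Proof.
move=> defG /setIP[Gx cNx] cxy; rewrite inE Gx -defG centM inE cNx.
by rewrite cent_cycle; apply/cent1P.
Qed.

(** A nontrivial [m] in ['Ohm_1('Z(N))] gives an [h] that moves [g] to [g * m], which differs from
    [g]. *)
Lemma cent_maximal_noncentral (N : {group gT}) :
  maximal N G -> exists2 h, h \in 'C_G(N) & h \notin 'Z(G).
Proof.
move=> maxN; have /properP[sNG [g Gg N'g]] := maxgroupp maxN.
have pN := pgroupS sNG pG.
have: 'Ohm_1('Z(N)) != 1.
  rewrite Ohm1_eq1; apply: contra (maximal_neq1 maxN) => /eqP Z1.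
  by rewrite (trivg_center_pgroup pN).
case/trivgPn=> m Mm ntm.
have [h Ch gh] := maximal_displacement p_pr pG sG innG maxN Gg N'g Mm.
exists h => //; apply: contra ntm => /centerP[_ cGh].
by rewrite -(mulKg g m) -gh conjgE -cGh // mulKg mulVg.
Qed.

(** A central element outside [N] would generate [G] together with [N], making all of ['C_G(N)]
    central. *)
Lemma center_sub_maximal (N : {group gT}) : maximal N G -> 'Z(G) \subset N.
Proof.
move=> maxN; have [h Ch] := cent_maximal_noncentral maxN.
apply: contraR => /subsetPn[z /centerP[Gz cGz] N'z].
apply: (mem_center_mul (maximal_joinE pG maxN Gz N'z) Ch).
by apply/commute_sym/cGz; case/setIP: Ch.
Qed.

Lemma cent_maximal_sub (N : {group gT}) : maximal N G -> 'C_G(N) \subset 'Z(N).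
Proof.
move=> maxN; apply/subsetP=> c Cc; have [Gc cNc] := setIP Cc.
rewrite inE cNc andbT; apply: contraT => N'c; rewrite -(negPf N'c).
apply: (subsetP (center_sub_maximal maxN)).
exact: (mem_center_mul (maximal_joinE pG maxN Gc N'c)).
Qed.

Lemma card_maximal_inter (N1 N2 : {group gT}) a :
  maximal N1 G -> maximal N2 G -> a \in N1 -> a \notin N2 ->
  #|G| = (#|N1 :&: N2| * p * p)%N.
Proof.
move=> max1 max2 N1a N2'a.
have [s1 s2] := (proper_sub (maxgroupp max1), proper_sub (maxgroupp max2)).
have defG : N2 * N1 = G.
  apply: (mulg_normal_maximal _ max2) => //; first exact: p_maximal_normal pG _.
  by apply/subsetPn; exists a.
have o1 := Lagrange s1; rewrite (p_maximal_index pG max1) in o1.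
have o2 := Lagrange s2; rewrite (p_maximal_index pG max2) in o2.
have := mul_cardG N2 N1; rewrite defG setIC -{1}o1 mulnC -mulnA => /eqP.
rewrite eqn_pmul2l ?cardG_gt0 // => /eqP o2I.
by rewrite -o2 o2I (mulnC p).
Qed.

(** Take a maximal [M] above the join, and let [K] be one of [N1], [N2] that misses [x]. By
    cardinality [M :&: K] is [N1 :&: N2], so [x] and this intersection generate [M]. *)
Lemma join_cycle_maximal (N1 N2 : {group gT}) a x :
  maximal N1 G -> maximal N2 G -> a \in N1 -> a \notin N2 ->
  x \in G -> x \notin N1 :&: N2 -> (N1 :&: N2) <*> <[x]> != G ->
  maximal ((N1 :&: N2) <*> <[x]>) G.
Proof.
move=> max1 max2 N1a N2'a Gx N'x neqG; have pp0 := prime_gt0 p_pr.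
have sNG : N1 :&: N2 \subset G by rewrite subIset // proper_sub ?(maxgroupp max1).
have sLG : (N1 :&: N2) <*> <[x]> \subset G by rewrite join_subG sNG cycle_subG.
have [/= defG|[M maxM sLM]] := maximal_exists sLG; first by rewrite defG eqxx in neqG.
move: (sLM); rewrite join_subG cycle_subG => /andP[sNM Mx].
suffices -> : (N1 :&: N2) <*> <[x]> = M by [].
apply/eqP; rewrite eqEsubset sLM /=.
have [K [maxK sNK K'x]] : exists K : {group gT},
    [/\ maximal K G, N1 :&: N2 \subset K & x \notin K].
  move: N'x; rewrite inE negb_and => /orP[N1'x|N2'x].
    by exists N1; rewrite subsetIl.
  by exists N2; rewrite subsetIr.
have defN : N1 :&: N2 = M :&: K.
  apply/eqP; rewrite eqEcard subsetI sNM sNK /=.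
  have := card_maximal_inter max1 max2 N1a N2'a.
  rewrite (card_maximal_inter maxM maxK Mx K'x) => /eqP.
  by rewrite !eqn_pmul2r // => /eqP->.
rewrite -{1}(maximal_inter_joinE pG maxM maxK Mx K'x) -defN.
by rewrite mul_subG ?joing_subl ?joing_subr.
Qed.

Lemma der1_maximal (N : {group gT}) x y :
  maximal N G -> x \in G -> y \in G -> [~ x, y] \in N.
Proof.
move=> maxN Gx Gy; apply: (subsetP (Phi_sub_max maxN)).
rewrite (Phi_joing pG); apply: (subsetP (joing_subl _ _)).
exact: mem_commg.
Qed.

Lemma expgp_maximal (N : {group gT}) x : maximal N G -> x \in G -> x ^+ p \in N.
Proof.
move=> maxN Gx; have [Nx|N'x] := boolP (x \in N); first by rewrite groupX.
by rewrite (expg_mem_maximal p_pr pG) ?dvdnn.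
Qed.

(** Some [k] in ['Z(M)] moves [y] to [y * m]. Writing [k = n * x ^+ i], the factor [n] is in
    ['Z(N)], hence central in [G], so [x ^+ i] already does it and [m = [~ y, x] ^+ i]. *)
Lemma Ohm1_center_sub_commutator (N M : {group gT}) x y :
  N \subset G -> 'Z(N) \subset 'Z(G) -> maximal M G -> N * <[x]> = M ->
  x \in 'C_G(N) -> y \in G -> y \notin M -> [~ y, x] \in 'Z(G) ->
  'Ohm_1('Z(M)) \subset <[ [~ y, x] ]>.
Proof.
move=> sNG sZ maxM defM Cx Gy M'y Zyx.
apply/subsetP=> m Mm; have [Gx cNx] := setIP Cx.
have [k Ck yk] := maximal_displacement p_pr pG sG innG maxM Gy M'y Mm.
have [Gk cMk] := setIP Ck.
have /centerP[Mk _] := subsetP (cent_maximal_sub maxM) k Ck.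
move: (Mk); rewrite -defM => /mulsgP[n _ Nn /cycleP[i ->] defk].
have sNM : N \subset M by rewrite -defM mulg_subl ?group1.
have Zn : n \in 'Z(G).
  have defn : n = k * x ^- i by rewrite defk mulgK.
  apply: (subsetP sZ); rewrite inE Nn defn.
  by rewrite groupM ?groupV ?groupX // (subsetP (centS sNM)).
have {}yk : y ^ (x ^+ i) = y * m.
  rewrite -yk defk conjgM [y ^ n]conjgE.
  by have /centerP[_ cn] := Zn; rewrite -cn // mulKg.
have -> : m = [~ y, x] ^+ i.
  rewrite -commgX ?commgEl ?yk ?mulKg //.
  by have /centerP[_ c] := Zyx; apply/commute_sym/c.
exact: mem_cycle.
Qed.

Lemma card_Ohm1_center_le (N : {group gT}) u :
  u ^+ p = 1 -> 'Ohm_1('Z(N)) \subset <[u]> -> #|'Ohm_1('Z(N))| <= p.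
Proof.
move=> up1 sOu; apply: leq_trans (subset_leq_card sOu) _.
by rewrite dvdn_leq ?prime_gt0 // order_dvdn up1.
Qed.

(** A [c] outside [N2] would centralize [N1 :&: N2] from outside; the index of ['Z(N)] in [C] is
    then computed exactly and bounded by counting [p]-th powers. *)
Lemma maximal_center_sub (N1 N2 : {group gT}) c :
  maximal N1 G -> maximal N2 G -> c \in 'Z(N1) -> c \in N2.
Proof.
move=> max1 max2 /centerP[N1c cN1c]; apply: contraT => N2'c.
have [s1 s2] := (proper_sub (maxgroupp max1), proper_sub (maxgroupp max2)).
have [h Ch Z'h] := cent_maximal_noncentral max2; have [Gh cN2h] := setIP Ch.
have Gc := subsetP s1 c N1c.
have /centerP[N2h _] := subsetP (cent_maximal_sub max2) h Ch.
(* Inside [N1], [h] would commute with [c] as well as with [N2], hence be central. *)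
have N1'h : h \notin N1.
  apply: contra Z'h => N1h.
  apply: mem_center_mul (maximal_joinE pG max2 Gc N2'c) Ch _.
  exact/commute_sym/cN1c.
pose N := (N1 :&: N2)%G; pose C := 'C_G(N)%G.
have [sN1 sN2] : N \subset N1 /\ N \subset N2 by rewrite subsetIl subsetIr.
have sNG := subset_trans sN1 s1; have pN := pgroupS sNG pG.
have defN1 : N * <[c]> = N1 by exact: (maximal_inter_joinE pG max1 max2 N1c N2'c).
have defN2 : N * <[h]> = N2.
  by rewrite /= setIC; apply: (maximal_inter_joinE pG max2 max1 N2h N1'h).
have defG : N1 * <[h]> = G by apply: (maximal_joinE pG).
have genG (M : {group gT}) : N \subset M -> c \in M -> h \in M -> G \subset M.
  move=> sNM Mc Mh; rewrite -defG mul_subG ?cycle_subG //.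
  by rewrite -defN1 mul_subG ?cycle_subG.
have Cc : c \in C by rewrite inE Gc; apply/centP=> x Nx; apply/cN1c/(subsetP sN1).
have {}Ch : h \in C by rewrite inE Gh (subsetP (centS sN2)).
have sZ : 'Z(N) \subset 'Z(G).
  apply/subsetP=> d /centerP[Nd cNd].
  apply: mem_center_mul defG _ _.
    rewrite in_setI (subsetP sNG) // -defN1 centM in_setI cent_cycle.
    apply/and3P; split=> //; first by apply/centP=> x /cNd.
    by apply/cent1P/commute_sym/cN1c/(subsetP sN1).
  by apply/commute_sym/(centP cN2h)/(subsetP sN2).
have com x y : x \in C -> y \in C -> [~ y, x] \in 'Z(N).
  move=> Cx Cy; have [[Gx _] [Gy _]] := (setIP Cx, setIP Cy).
  rewrite in_setI in_setI (der1_maximal max1) // (der1_maximal max2) //=.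
  by have: [~ y, x] \in C; [rewrite groupR | case/setIP].
have expC x : x \in C -> x ^+ p \in 'Z(N).
  move=> Cx; have [Gx cNx] := setIP Cx.
  by rewrite in_setI in_setI (expgp_maximal max1) // (expgp_maximal max2) //= groupX.
(* If such an [x] lay outside [N], then [M = N <*> <[x]>] would be maximal. For [y] in [C] outside
   [M], ['Ohm_1('Z(M))] would lie in [<[ [~ y, x] ]>], hence in [N], although it contains [x]. *)
have noexp x : x \in C -> x ^+ p = 1 -> x \in N.
  move=> Cx xp1; apply: contraT => N'x; have [Gx cNx] := setIP Cx.
  have nNx : <[x]> \subset 'N(N) by rewrite cents_norm // cycle_subG.
  have neqG : N <*> <[x]> != G.
    apply: contra N'x; rewrite norm_joinEr // => /eqP defGx.
    have Zx := mem_center_mul defGx Cx (erefl _).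
    rewrite in_setI (subsetP (center_sub_maximal max1) _ Zx) /=.
    by rewrite (subsetP (center_sub_maximal max2) _ Zx).
  have maxM := join_cycle_maximal max1 max2 N1c N2'c Gx N'x neqG.
  have [y Cy M'y] : exists2 y, y \in C & y \notin N <*> <[x]>.
    have: ~~ (C \subset N <*> <[x]>).
      apply: contra neqG => sCM; rewrite eqEsubset join_subG sNG cycle_subG Gx /=.
      by rewrite genG ?joing_subl // (subsetP sCM).
    by case/subsetPn=> y; exists y.
  have [Gy _] := setIP Cy.
  have sO := Ohm1_center_sub_commutator sNG sZ maxM _ Cx Gy M'y
    (subsetP sZ _ (com x y Cx Cy)).
  rewrite -norm_joinEr // in sO; have {}sO := sO erefl.
  have pM := pgroupS (proper_sub (maxgroupp maxM)) pG.
  have: x \in 'Ohm_1('Z(N <*> <[x]>)).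
    rewrite (mem_Ohm1_center _ pM) xp1 eqxx andbT.
    rewrite inE (subsetP (joing_subr _ _)) ?cycle_id //=.
    by rewrite centY inE cNx cent_cycle cent1id.
  have sUN : <[ [~ y, x] ]> \subset N.
    by rewrite cycle_subG; case/centerP: (com x y Cx Cy).
  by move/(subsetP sO)/(subsetP sUN); rewrite (negPf N'x).
(* [[~ h, c] ^+ p] equals [[~ h, c ^+ p]], and [c ^+ p] is central. *)
have oW : #|'Ohm_1('Z(N))| <= p.
  apply: (@card_Ohm1_center_le _ [~ h, c]).
    rewrite -commgX.
      apply/eqP/commgP; have /centerP[_ cp] := subsetP sZ _ (expC c Cc).
      exact/commute_sym/cp.
    by have /centerP[_ cu] := subsetP sZ _ (com c h Cc Ch); apply/commute_sym/cu.
  apply: subset_trans (Ohm1_center_sub_commutator sNG sZ max1 defN1 Cc Gh N1'h _).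
    apply: OhmS; apply/subsetP=> z Zz; have /centerP[Nz _] := Zz.
    rewrite inE (subsetP sN1) //; have /centerP[_ cGz] := subsetP sZ z Zz.
    by apply/centP=> w N1w; apply/cGz/(subsetP s1).
  exact: (subsetP sZ _ (com c h Cc Ch)).
have oC : #|C| = (#|'Z(N)| * p * p)%N.
  have defNC : N * C = G.
    have nNC : C \subset 'N(N) by rewrite cents_norm ?subsetIr.
    have sCM := subsetP (joing_subr N C).
    rewrite -norm_joinEr //; apply/eqP; rewrite eqEsubset join_subG sNG subsetIl.
    by rewrite genG ?joing_subl ?sCM.
  have := mul_cardG N C; rewrite defNC (card_maximal_inter max1 max2 N1c N2'c).
  rewrite setIA (setIidPl sNG) -!mulnA => /eqP; rewrite eqn_pmul2l ?cardG_gt0 //.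
  by move=> /eqP->; rewrite mulnA mulnC mulnA.
(* [C] is split into fibres of the [p]-th power map, with values in ['Z(N)]. By semi-abelianness and
   [noexp], each nonempty fibre lies in one coset of ['Ohm_1('Z(N))]. *)
have: #|C| <= #|'Z(N)| * p.
  rewrite -sum1_card (partition_big (fun x => x ^+ p) (mem 'Z(N))) //=.
  rewrite -sum_nat_const; apply: leq_sum => d _.
  rewrite sum1dep_card; set X := [set _ | _]; have [->|[x0]] := set_0Vmem X.
    by rewrite cards0.
  rewrite inE => /andP[Cx0 /eqP x0p]; apply: leq_trans oW.
  rewrite -(card_rcoset 'Ohm_1('Z(N)) x0); apply/subset_leq_card/subsetP=> x.
  rewrite inE => /andP[Cx /eqP xp]; rewrite mem_rcoset.
  have [[Gx _] [Gx0 _]] := (setIP Cx, setIP Cx0).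
  have e := semi_abelian_expg_eq sG Gx Gx0 (etrans xp (esym x0p)).
  rewrite (mem_Ohm1_center _ pN) e eqxx andbT.
  have Cxx : x * x0^-1 \in C by rewrite groupM ?groupV.
  by rewrite inE noexp //; case/setIP: Cxx.
rewrite oC leqNgt -{1}[(_ * p)%N]muln1 ltn_pmul2l ?prime_gt1 //.
by rewrite muln_gt0 cardG_gt0 prime_gt0.
Qed.

(** An element [c] of the centralizer outside [N1 :&: N2] would be central in the maximal subgroup
    it generates with [N1 :&: N2], so [maximal_center_sub] would put it in both [N1] and [N2]. *)
Lemma cent_maximal_inter_sub (N1 N2 : {group gT}) a :
  maximal N1 G -> maximal N2 G -> a \in N1 -> a \notin N2 ->
  'C_G(N1 :&: N2) \subset N1 :&: N2.
Proof.
move=> max1 max2 N1a N2'a; apply/subsetP=> c Cc; have [Gc cNc] := setIP Cc.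
apply: contraT => N'c; set N := (N1 :&: N2)%G.
have nNc : <[c]> \subset 'N(N) by rewrite cents_norm // cycle_subG.
have neqG : N <*> <[c]> != G.
  apply: contra N'c; rewrite norm_joinEr // => /eqP defGc.
  have Zc := mem_center_mul defGc Cc (erefl _).
  rewrite in_setI (subsetP (center_sub_maximal max1) _ Zc).
  by rewrite (subsetP (center_sub_maximal max2) _ Zc).
have max3 := join_cycle_maximal max1 max2 N1a N2'a Gc N'c neqG.
have Zc : c \in 'Z(N <*> <[c]>).
  rewrite inE (subsetP (joing_subr _ _)) ?cycle_id //=.
  by rewrite centY inE cNc cent_cycle cent1id.
by move: N'c; rewrite inE !(maximal_center_sub max3 _ Zc).
Qed.
End Inner.

(** * Counting derivations against inner ones *)

Lemma card_image_ker (aT rT : finGroupType) (D : {group aT})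
    (f : {morphism D >-> rT}) : (#|f @* D| * #|'ker f| = #|D|)%N.
Proof. by rewrite card_morphim setIid mulnC Lagrange ?subsetIl. Qed.

Lemma exists_noninner_order_p (p : nat) (gT : finGroupType) (G : {group gT}) :
  prime p -> p.-group G -> semi_abelian p G -> ~~ simple G -> G :!=: 1 ->
  ~ order_p_inner p G.
Proof.
move=> p_pr pG sG nsimG ntG innG.
have [/= G1|[N1 max1 _]] := maximal_exists (sub1G G); first by rewrite -G1 eqxx in ntG.
have [s1 [b Gb N1'b]] := properP (maxgroupp max1).
have sbG : <[b]> \subset G by rewrite cycle_subG.
(* If [b] generated [G], then [G] would be abelian, against [cent_maximal_noncentral]. *)
have [/= defG|[N2 max2]] := maximal_exists sbG.
  have [h] := cent_maximal_noncentral p_pr pG sG innG nsimG ntG max1.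
  case/setIP=> Gh _; rewrite inE Gh /=; case/negP.
  by apply: subsetP Gh; rewrite -{1}defG -defG; apply: cycle_abelian.
rewrite cycle_subG => N2b; have s2 := proper_sub (maxgroupp max2).
have [a N1a N2'a] : exists2 a, a \in N1 & a \notin N2.
  apply/subsetPn; apply: contra N1'b => s12; have [_ maxN1] := maxgroupP max1.
  by rewrite -(maxN1 N2 (maxgroupp max2) s12).
pose N := (N1 :&: N2)%G; pose A := 'Z(N)%G; pose M := 'Ohm_1('Z(N))%G.
have [ns1 ns2] := (p_maximal_normal pG max1, p_maximal_normal pG max2).
have /andP[sNG nNG] : N <| G by apply: normalI.
have pN := pgroupS sNG pG.
have nAG : G \subset 'N(A) by apply: gFnorm_trans.
have nMG : G \subset 'N(M) by rewrite !gFnorm_trans.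
have sMA : M \subset A := Ohm_sub _ _.
have sAG : A \subset G := subset_trans (center_sub _) sNG.
have abA : abelian A := center_abelian N.
have abM : abelian M := abelianS sMA abA.
have Ga := subsetP s1 a N1a.
have sCN : 'C_G(N) \subset N.
  exact: (cent_maximal_inter_sub p_pr pG sG innG nsimG ntG max1 max2 N1a N2'a).
have ntM : M :!=: 1.
  rewrite Ohm1_eq1; apply: contra ntG => /eqP Z1.
  have N_1 := trivg_center_pgroup pN Z1.
  have sGC : G \subset 'C_G(N) by rewrite subsetI subxx centsC N_1 sub1G.
  by rewrite -subG1 -N_1 (subset_trans sGC).
have cA := centsP abA.
have AJ g h : g \in G -> h \in A -> [~ g, h] \in A.
  move=> Gg Ah; rewrite commgEr groupM // memJ_norm ?groupV //.
  exact: (subsetP nAG).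
have commM g : g \in G -> {in A &, {morph (fun h => [~ g, h]) : x y / x * y}}.
  move=> Gg x y Ax Ay /=; have [Agx Agy] := (AJ g x Gg Ax, AJ g y Gg Ay).
  by rewrite commgMJ (conjgE _ y) -(cA y Ay _ Agx) mulKg; apply: cA.
(* These are the displacements of [a] and [b] under conjugation by [h]. *)
pose kappa h := ([~ a, h], [~ b, h]).
have kappaM : {in A &, {morph kappa : x y / x * y}}.
  by move=> x y Ax Ay; rewrite /kappa !commM.
pose kap := Morphism kappaM.
(* The kernel of [phi] on pairs from [M] is given by the commutator condition of
   [two_maximal_displacement]. *)
pose phi (m : gT * gT) := [~ b, m.1] * [~ a, m.2]^-1.
have phiM : {in setX_group M M &, {morph phi : x y / x * y}}.
  move=> [x1 x2] [y1 y2] /setXP[/= Mx1 Mx2] /setXP[/= My1 My2].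
  have sMA' := subsetP sMA.
  rewrite /phi /= !commM ?sMA' // invMg.
  have Au : [~ b, y1] * [~ a, y2]^-1 \in A by rewrite !(AJ, groupM, groupV) ?sMA'.
  have Av : [~ a, x2]^-1 \in A by rewrite groupV AJ ?sMA'.
  move: {Au Av}(cA _ Av _ Au); move: [~ b, x1] [~ b, y1] [~ a, x2] [~ a, y2].
  by rewrite /commute => u v w z e; rewrite -!mulgA e -!mulgA.
pose Phi := Morphism phiM; pose S := 'ker Phi.
(* The image of [phi] lies in [[~: M, G]], which is proper in [M] by nilpotency, whereas its domain
   has [#|M| ^ 2] elements. *)
have ltMS : #|M| < #|S|.
  have imPhi : Phi @* setX_group M M \subset [~: M, G].
    apply/subsetP=> _ /morphimP[[m1 m2] _ /setXP[/= Mm1 Mm2] ->].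
    rewrite /= /phi /= groupM ?groupV //.
      by rewrite -invg_comm groupV mem_commg.
    by rewrite -invg_comm groupV mem_commg.
  have ltMG : #|[~: M, G]| < #|M|.
    apply: proper_card; apply: (nil_comm_properl (pgroup_nil pG)) => //.
      exact: subset_trans sMA sAG.
    by rewrite subsetI subxx.
  have := card_image_ker Phi; rewrite cardsX => cardM.
  have ltIm := leq_ltn_trans (subset_leq_card imPhi) ltMG.
  rewrite ltnNge; apply/negP=> leSM.
  have := leq_ltn_trans (leq_mul (leqnn #|Phi @* setX_group M M|) leSM).
  by move=> /(_ (#|M| * #|M|)%N); rewrite cardM ltnn ltn_pmul2r ?cardG_gt0 //
    => /(_ ltIm).
have SM m1 m2 : (m1, m2) \in S -> [/\ m1 \in M, m2 \in M & [~ m1, b] = [~ m2, a]].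
  move=> Sm; have /setXP[/= Mm1 Mm2] := dom_ker Sm; split=> //.
  have /= := mker Sm; rewrite /phi /= => /eqP; rewrite -eq_mulgV1 => /eqP e.
  by rewrite -invg_comm e invg_comm.
have sSk : S \subset kap @* A.
  apply/subsetP=> [[m1 m2]] /SM[Mm1 Mm2 e].
  have [h [Ch ah bh]] := two_maximal_displacement p_pr pG sG innG max1 max2
    N1a N2'a N2b N1'b Mm1 Mm2 e.
  have Ah : h \in A by rewrite inE (subsetP sCN) //; case/setIP: Ch.
  apply/morphimP; exists h => //=.
  by rewrite /kappa !commgEl ah bh !mulKg.
have cardT := card_morphpre sSk.
have powM : {in kap @*^-1 S &, {morph (fun h => h ^+ p) : x y / x * y}}.
  move=> x y /morphpreP[Ax _] /morphpreP[Ay _] /=.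
  by apply: expgMn; apply: cA.
pose pow := Morphism powM.
have cardP := card_image_ker pow.
have sKM : 'ker pow \subset M.
  apply/subsetP=> h Kh; have /morphpreP[Ah _] := dom_ker Kh.
  rewrite (mem_Ohm1_center _ pN) Ah /=.
  by have /= := mker Kh => ->.
(* Since [h] commutes with [[~ a, h]], one has [[~ a, h ^+ p] = [~ a, h] ^+ p], trivial because
   [[~ a, h]] is in [M]; likewise for [b]. *)
have imP : pow @* (kap @*^-1 S) \subset 'ker kap.
  apply/subsetP=> _ /morphimP[h _ /morphpreP[Ah Sh] ->] /=.
  have [Mm1 Mm2 _] := SM _ _ Sh.
  move: Mm1 Mm2; rewrite !(mem_Ohm1_center _ pN) => /andP[_ /eqP e1] /andP[_ /eqP e2].
  apply/(kerP kap (groupX p Ah)) => /=.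
  by rewrite /kappa !commgX ?e1 ?e2 //; apply: cA; rewrite ?AJ.
(* The preimage of [S] under [kap] has order [#|'ker kap| * #|S|], but through [pow] at most
   [#|'ker kap| * #|M|]. *)
move: cardP; rewrite cardT => cardP.
have : (#|'ker kap| * #|S| <= #|'ker kap| * #|M|)%N.
  by rewrite -cardP leq_mul // subset_leq_card.
by rewrite leq_pmul2l ?cardG_gt0 // leqNgt ltMS.
Qed.

Theorem theorem1p3 (p : nat) (gT : finGroupType) (G : {group gT}) :
  prime p -> p.-group G -> semi_abelian p G ->
  ~~ simple G -> G :!=: 1 ->
  exists f : {perm gT},
    [/\ f \in Aut G, f \notin inner_automorphisms G & #[f] = p].
Proof.
move=> p_pr pG sG nsimG ntG.
pose P (f : {perm gT}) := [&& f \in Aut G, f \notin inner_automorphisms G & #[f] == p].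
have [f /and3P[? ? /eqP ?]|noP] := pickP P; first by exists f.
case: (exists_noninner_order_p p_pr pG sG nsimG ntG) => f Af of_p.
by move/negbT: (noP f); rewrite /P Af of_p eqxx andbT negbK.
Qed.
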